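(* Let $P$ and $Q$ be real monic polynomials with $\deg(P)=3$ and $\deg(Q)=2$, neither of which has a zero in $\mathbb{C}_+$. Let $(L_t)_{t\in\mathbb{R}}$ be a two-sided subordinator with non-zero Lévy measure and $\mathbb{E}[L_1]<\infty$, and let $(Y_t)_{t\in\mathbb{R}}$ be the causal and invertible CARMA($3,2$) process driven by $(L_t)_{t\in\mathbb{R}}$ with autoregressive polynomial $P$ and moving average polynomial $Q$. Let $\beta_1$ and $\beta_2$, with $\operatorname{Re}(\beta_1)\ge\operatorname{Re}(\beta_2)$, denote the zeroes of $Q$ (counted with multiplicity). Let $R(z)=(z+\lambda)Q(z)-P(z)$, where $\lambda\in\mathbb{R}$ is the unique constant such that $\deg(R)<2$, and let $f:[0,\infty)\to\mathbb{R}$ be the function characterized by $$\int_0^\infty e^{-ity}f(t)\,\mathrm{d}t=\frac{R(iy)}{Q(iy)},\qquad y\in\mathbb{R}.$$ Then $f$ is non-negative if and only if $\operatorname{Im}(\beta_1)=\operatorname{Im}(\beta_2)=0$ and one of the following conditions holds: (i) $\beta_1>\beta_2$ and $P(\beta_1)\le\min\{P(\beta_2),0\}$. (ii) $\beta_1=\beta_2$ and $\max\{P(\beta_1),P'(\beta_1)\}\le0$. In particular, if either (i) or (ii) is satisfied, then $(Y_t)_{t\in\mathbb{R}}$ is non-negative.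
   Context: $\mathbb{C}_+=\{z\in\mathbb{C}:\operatorname{Re}(z)\ge 0\}$. A two-sided subordinator is $L_t=L^1_t\mathbf{1}_{[0,\infty)}(t)-L^2_{(-t)-}\mathbf{1}_{(-\infty,0)}(t)$, $t\in\mathbb{R}$, where $L^1,L^2$ are independent processes with the same law, each starting at $0$ with càdlàg paths and stationary, independent, non-negative increments. CARMA process: for real monic polynomials $P(z)=z^p+a_1z^{p-1}+\cdots+a_p$ and $Q(z)=b_0+b_1z+\cdots+b_{q-1}z^{q-1}+z^q$ with $p>q$ and $P$ having no zeroes in $\mathbb{C}_+$ (causality), the causal CARMA($p,q$) process driven by $(L_t)_{t\in\mathbb{R}}$ is $$Y_t=\int_{-\infty}^t g(t-s)\,\mathrm{d}L_s,\quad t\in\mathbb{R},\qquad g(t)=\boldsymbol{b}^\top e^{\boldsymbol{A}t}\boldsymbol{e}_p,$$ where $\boldsymbol{A}\in\mathbb{R}^{p\times p}$ is the companion matrix with ones on the superdiagonal, last row $(-a_p,-a_{p-1},\dots,-a_1)$ and zeroes elsewhere, $\boldsymbol{b}=(b_0,\dots,b_{q-1},1,0,\dots,0)^\top\in\mathbb{R}^p$, and $\boldsymbol{e}_p=(0,\dots,0,1)^\top\in\mathbb{R}^p$. Equivalently, $\int_0^\infty e^{-ity}g(t)\,\mathrm{d}t=Q(iy)/P(iy)$ for $y\in\mathbb{R}$. It is called invertible if $Q$ has no zeroes in $\mathbb{C}_+$. The function $f$ is taken to be the continuous function with the stated Fourier transform. ''$(Y_t)_{t\in\mathbb{R}}$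 is non-negative'' means that $Y_t\ge0$ almost surely for each $t\in\mathbb{R}$.
   Formalization: The formal theorem adds the assumption that R is not the zero polynomial when the zeroes of Q are non-real; otherwise (e.g. Q=z²+2z+2, P=(z+1)Q) f=0 is non-negative although Im(β₁)≠0, so the stated equivalence fails. *)

(* Defs.v *)
From HB Require Import structures.
From mathcomp Require Import all_boot all_order all_algebra.
From mathcomp Require Import complex.
From mathcomp Require Import all_classical all_reals all_analysis.

Set Implicit Arguments.
Unset Strict Implicit.
Unset Printing Implicit Defensive.

Import Order.TTheory GRing.Theory Num.Theory.
Import numFieldNormedType.Exports.

Local Open Scope classical_set_scope.
Local Open Scope complex_scope.
Local Open Scope ring_scope.

Definition Cpoly (R : realType) (p : {poly R}) : {poly R[i]} :=
  map_poly (real_complex R) p.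

Definition no_zero_Cplus (R : realType) (p : {poly R}) : Prop :=
  forall z : R[i], 0 <= complex.Re z -> ~~ root (Cpoly p) z.

Definition expi (R : realType) (x : R) : R[i] := cos x +i* sin x.

Definition Cintegral (R : realType) (d : measure_display)
    (T : measurableType d) (mu : {measure set T -> \bar R}) (D : set T)
    (h : T -> R[i]) : R[i] :=
  (\int[mu]_(x in D) complex.Re (h x)) +i* (\int[mu]_(x in D) complex.Im (h x)).

(* The values of f at negative arguments are irrelevant: f stands for a
   function on [0, +oo[. Integrability makes the Fourier integral meaningful. *)
Definition continuous_with_fourier (R : realType) (f : R -> R)
    (F : R -> R[i]) : Prop :=
  [/\ {within `[0, +oo[, continuous f},
      lebesgue_measure.-integrable `[0, +oo[ (EFin \o f) &
      forall y : R,
        Cintegral lebesgue_measure `[0, +oo[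
          (fun t => expi (- (t * y)) * (f t)%:C) = F y].

(* Processes on the time set [0, +oo[ are functions X : R -> Omega -> R, the
   values X t at negative times t being irrelevant. *)

(* The sigma-algebra generated by the coordinate maps at nonnegative times. *)
Definition path_sigma (R : realType) : set (set (R -> R)) :=
  <<s [set E | exists t : R, exists2 B : set R,
         0 <= t /\ measurable B & E = [set x : R -> R | B (x t)]] >>.

Definition path_event (R : realType) (Omega : Type) (X : R -> Omega -> R)
    (E : set (R -> R)) : set Omega :=
  [set omega | E (fun t => X t omega)].

Definition same_law (R : realType) (d : measure_display)
    (Omega : measurableType d) (Pr : probability Omega R)
    (X Y : R -> Omega -> R) : Prop :=
  forall E, path_sigma E -> Pr (path_event X E) = Pr (path_event Y E).

Definition independent_processes (R : realType) (d : measure_display)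
    (Omega : measurableType d) (Pr : probability Omega R)
    (X Y : R -> Omega -> R) : Prop :=
  forall E F, path_sigma E -> path_sigma F ->
    Pr (path_event X E `&` path_event Y F) =
    (Pr (path_event X E) * Pr (path_event Y F))%E.

Definition cadlag (R : realType) (x : R -> R) : Prop :=
  (forall t, 0 <= t -> x s @[s --> t^'+] --> x t) /\
  (forall t, 0 < t -> cvg (x s @[s --> t^'-])).

Definition stationary_increments (R : realType) (d : measure_display)
    (Omega : measurableType d) (Pr : probability Omega R)
    (X : R -> Omega -> R) : Prop :=
  forall (s h : R) (B : set R), 0 <= s -> 0 <= h -> measurable B ->
    Pr [set omega | B (X (s + h) omega - X s omega)] =
    Pr [set omega | B (X h omega - X 0 omega)].

Definition independent_increments (R : realType) (d : measure_display)
    (Omega : measurableType d) (Pr : probability Omega R)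
    (X : R -> Omega -> R) : Prop :=
  forall (n : nat) (t : nat -> R) (B : nat -> set R),
    0 <= t 0%N -> {homo t : i j / (i <= j)%N >-> i <= j} ->
    (forall i, measurable (B i)) ->
    Pr [set omega | forall i, (i < n)%N ->
                      B i (X (t i.+1) omega - X (t i) omega)] =
    (\prod_(i < n)
       Pr [set omega | B i (X (t i.+1) omega - X (t i) omega)%R])%E.

Record subordinator (R : realType) (d : measure_display)
    (Omega : measurableType d) (Pr : probability Omega R)
    (X : R -> Omega -> R) : Prop := Subordinator {
  subordinator_measurable : forall t, 0 <= t -> measurable_fun setT (X t) ;
  subordinator_start : forall omega, X 0 omega = 0 ;
  subordinator_cadlag : forall omega, cadlag (X ^~ omega) ;
  subordinator_stationary : stationary_increments Pr X ;
  subordinator_independent : independent_increments Pr X ;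
  subordinator_nonneg : forall s t, 0 <= s -> s <= t ->
    {ae Pr, forall omega, 0 <= X t omega - X s omega} }.

Definition two_sided (R : realType) (Omega : Type) (L1 L2 : R -> Omega -> R)
    (t : R) (omega : Omega) : R :=
  if 0 <= t then L1 t omega
  else - lim (L2 s omega @[s --> (- t)^'-]).

(* Levy-Khintchine representation of a subordinator with drift gamma and Levy
   measure nu, through the Laplace transform at time 1. *)
Definition levy_measure (R : realType) (d : measure_display)
    (Omega : measurableType d) (Pr : probability Omega R)
    (X : R -> Omega -> R) (nu : {measure set R -> \bar R}) : Prop :=
  [/\ nu `]-oo, 0]%classic = 0%E,
      (\int[nu]_(x in `]0%R, +oo[) (Num.min 1 x)%:E < +oo)%E &
      exists2 gamma : R, 0 <= gamma &
        forall u : R, 0 <= u ->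
          'E_Pr[fun omega => expR (- (u * X 1 omega))%R]%E =
          (expR (- (gamma * u)
                 - \int[nu]_(x in `]0, +oo[) (1 - expR (- (u * x)))))%:E].

Definition expmx (R : realType) (n : nat) (A : 'M[R]_n) : 'M[R]_n :=
  limn (series (fun k : nat => (k`!%:R)^-1 *: A ^+ k)).

(* With p the degree of P and Q of degree less than p, companionmx P is the
   matrix A, the row below is the transpose of b, and the column is e_p. *)
Definition carma_kernel (R : realType) (P Q : {poly R}) (t : R) : R :=
  ((\row_(j < (size P).-1) Q`_j)
   *m expmx (t *: companionmx P)
   *m (\col_(i < (size P).-1) (i.+1 == (size P).-1)%:R)) 0 0.

(* The Lebesgue-Stieltjes integral of h over D with respect to a nondecreasing
   right-continuous F; it is 0 by convention for any other F. *)
Definition stieltjes_integral (R : realType) (F : R -> R) (D : set R)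
    (h : R -> R) : R :=
  match pselect (exists G : cumulative R R, (G : R -> R) = F) with
  | left exG => \int[lebesgue_stieltjes_measure (projT1 (cid exG))]_(s in D) h s
  | right _ => 0
  end.

(* The paths of L are almost surely nondecreasing and right-continuous, so the
   integral is taken pathwise. *)
Definition carma (R : realType) (Omega : Type) (P Q : {poly R})
    (L : R -> Omega -> R) (t : R) (omega : Omega) : R :=
  stieltjes_integral (L ^~ omega) `]-oo, t] (fun s => carma_kernel P Q (t - s)).

(* Main.v *)
Require Import Defs.
From HB Require Import structures.
From mathcomp Require Import all_boot all_order all_algebra.
From mathcomp Require Import complex.
From mathcomp Require Import all_classical all_reals all_analysis.
From mathcomp Require Import measurable_realfun ring lra.

(** Polynomial division of P by Q reads P / Q = z + lambda - S / Q.  Since S / Q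
    is the transform of f and Q / P that of the kernel g of the CARMA process,
    g solves the delay equation g' = - lambda g + f * g with g(0) = 1, and a
    non-negative f keeps g positive.  Everything therefore rests on the sign of
    f.

    Suppose that the zeroes b1 >= b2 of Q are real and write S = s0 + s1 z.
    Then f(t) = S(b1) u(t) + s1 e^(b2 t), where u' = b1 u + e^(b2 t) and
    u(0) = 0.  This u satisfies u(t) >= t e^(b2 t) for t >= 0, so that the first
    term wins for large t, while f(0) = s1: f is non-negative exactly when
    S(b1) >= 0 and s1 >= 0 ([fourier_real_ge0]).  As P = (z + lambda) Q - S, the
    number S(b1) is - P(b1), and s1 is the slope of - P between b2 and b1, which
    is - P'(b1) if b1 = b2; these two inequalities are thus the conditions of
    the theorem in both cases ([carma_conditionsP]).  If the zeroes are
    not real, then f is a damped oscillation, which takes negative values unless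
    S = 0 ([fourier_complex_not_ge0]).

    The formula for f is obtained by computing the transform of the explicit
    candidate, a solution of Q(D) w = 0, from a primitive of w(t) e^(-ity)
    ([fourier_ode_cos_sin]), and by proving that the Fourier transform is
    injective on continuous integrable functions of [0, +oo[
    ([fourier_injective]).  The latter is the classical argument with the Fejer
    kernel: by Fubini, a function with zero transform has zero averages against
    the kernels, and these concentrate at any given point.

    For the process, the delay equation is replaced by a linear system in three
    unknowns.  The state vector of the CARMA kernel is made of x, x', x'' with
    P(D) x = 0 and g = Q(D) x.  With xi = x' - b1 x one has x' = b1 x + xi,
    xi' = b2 xi + g and g' = - lambda g + S(b1) x + s1 xi.  All the coupling
    coefficients 1, S(b1), s1 are non-negative, so g stays non-negative
    ([cascade_ge0]); this is the convolution argument for this particular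
    f.  The value Y_t is then the integral of a non-negative function along each
    path. *)

Set Implicit Arguments.
Unset Strict Implicit.
Unset Printing Implicit Defensive.

Import Order.TTheory GRing.Theory Num.Theory.
Import numFieldNormedType.Exports.

Local Open Scope classical_set_scope.
Local Open Scope complex_scope.
Local Open Scope ring_scope.

(** * Derivatives and linear differential inequalities *)
Section calculus.
Variable R : realType.
Implicit Types (f g : R -> R) (a b t : R).

(** The rules below apply to functions given by a formula, rather than by an
    operation of the ring of functions; the derivative of an explicit expression
    can then be written as one term that follows its structure. *)
Lemma is_derive_addf f g t df dg : is_derive t 1 f df -> is_derive t 1 g dg ->
  is_derive t 1 (fun x => f x + g x) (df + dg).
Proof. by move=> hf hg; exact: is_deriveD. Qed.

Lemma is_derive_mulf f g t df dg : is_derive t 1 f df -> is_derive t 1 g dg ->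
  is_derive t 1 (fun x => f x * g x) (df * g t + f t * dg).
Proof.
by move=> hf hg; apply: is_derive_eq (is_deriveM hf hg) _;
  rewrite /GRing.scale/= addrC mulrC.
Qed.

Lemma is_derive_scalef f t df a : is_derive t 1 f df ->
  is_derive t 1 (fun x => a * f x) (a * df).
Proof. by move=> hf; exact: is_deriveZ. Qed.

Lemma is_derive_line a t : is_derive t (1 : R) (fun x => a * x) a.
Proof.
by apply: is_derive_eq (is_derive_scalef a (is_derive_id t 1)) _; rewrite mulr1.
Qed.

Lemma is_derive_expRM a t :
  is_derive t 1 (fun x => expR (a * x)) (a * expR (a * t)).
Proof.
apply: is_derive_eq (is_derive1_comp (is_derive_expR _) (is_derive_line a t)) _.
by rewrite mulrC.
Qed.

Lemma is_derive_cosM a t :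
  is_derive t 1 (fun x => cos (a * x)) (- (a * sin (a * t))).
Proof.
apply: is_derive_eq (is_derive1_comp (is_derive_cos _) (is_derive_line a t)) _.
by rewrite mulrC mulrN.
Qed.

Lemma is_derive_sinM a t :
  is_derive t 1 (fun x => sin (a * x)) (a * cos (a * t)).
Proof.
apply: is_derive_eq (is_derive1_comp (is_derive_sin _) (is_derive_line a t)) _.
by rewrite mulrC.
Qed.

Lemma is_derive_continuous f (df : R -> R) :
  (forall t, is_derive t 1 f (df t)) -> continuous f.
Proof.
by move=> hf t; apply/differentiable_continuous/derivable1_diffP; case: (hf t).
Qed.

(** The product e^(-at) u(t) has derivative e^(-at) v(t), so it increases. *)
Lemma linear_ode_ge a (u v : R -> R) T :
  (forall t, is_derive t 1 u (a * u t + v t)) ->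
  (forall t, 0 < t < T -> 0 <= v t) ->
  forall t, 0 <= t <= T -> expR (a * t) * u 0 <= u t.
Proof.
move=> du v_ge0 t /andP[t0 tT].
pose w (x : R) : R := expR (- a * x) * u x.
have dw (x : R) : is_derive x 1 w (expR (- a * x) * v x).
  apply: is_derive_eq (is_derive_mulf (is_derive_expRM _ _) (du x)) _; ring.
have : w 0 <= w t.
  apply: (@ger0_derive1_le_cc _ w 0 T) => //; rewrite ?in_itv/= ?lexx ?t0//.
  - move=> x; rewrite in_itv/= => xT.
    rewrite derive1E (@derive_val _ _ _ _ _ _ _ (dw x)).
    by rewrite mulr_ge0 ?expR_ge0 ?v_ge0.
  - exact: continuous_subspaceT (is_derive_continuous dw).
  - by rewrite (le_trans t0).
rewrite /w mulr0 expR0 mul1r => /(ler_wpM2l (expR_ge0 (a * t))).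
by rewrite mulrA -expRD mulNr subrr expR0 mul1r.
Qed.

(** Up to the first time T at which g is not positive, xi is driven by a
    non-negative input, hence so is x, hence so is g; but then g(T) is at least
    e^(- lam T) g(0) > 0, and there is no such time. *)
Lemma cascade_ge0 (lam b1 b2 c s : R) (g xi x : R -> R) :
  0 <= c -> 0 <= s ->
  (forall t, is_derive t 1 g (- lam * g t + (c * x t + s * xi t))) ->
  (forall t, is_derive t 1 xi (b2 * xi t + g t)) ->
  (forall t, is_derive t 1 x (b1 * x t + xi t)) ->
  0 < g 0 -> 0 <= xi 0 -> 0 <= x 0 -> forall t, 0 <= t -> 0 <= g t.
Proof.
move=> c0 s0 dg dxi dx g0 xi0 x0 t t0; rewrite leNgt; apply/negP => gt0.
have cg := is_derive_continuous dg.
pose A := [set r | 0 <= r /\ g r <= 0].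
have At : A t by split=> //; exact: ltW.
have lbA : lbound A 0 by move=> r [].
have hiA : has_inf A by split; [exists t | exists 0].
pose T := inf A.
have T0 : 0 <= T by apply: lb_le_inf => //; exists t.
have gpos r : 0 <= r -> r < T -> 0 < g r.
  move=> r0 rT; rewrite ltNge; apply/negP => gr.
  by move: rT; rewrite ltNge (ge_inf (proj2 hiA))//; split.
have gT : g T <= 0.
  rewrite leNgt; apply/negP => gT0.
  have /cg : nbhs (g T) [set y | 0 < y] by exact: lt_nbhsr.
  case/nbhs_ballP => e /= e0 ball_pos.
  have [r [r0 gr] rT] := inf_adherent e0 hiA.
  have Tr : T <= r by apply: ge_inf => //; exact: (proj2 hiA).
  have : 0 < g r.
    by apply: ball_pos; rewrite /ball/= distrC ger0_norm ?subr_ge0// ltrBlDl.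
  by rewrite ltNge gr.
have xi_ge0 r : 0 <= r <= T -> 0 <= xi r.
  move=> rT; apply: le_trans (linear_ode_ge dxi _ rT).
    by rewrite mulr_ge0 ?expR_ge0.
  by move=> q /andP[q0 qT]; rewrite ltW// gpos// ltW.
have x_ge0 r : 0 <= r <= T -> 0 <= x r.
  move=> rT; apply: le_trans (linear_ode_ge dx _ rT).
    by rewrite mulr_ge0 ?expR_ge0.
  by move=> q /andP[q0 qT]; rewrite xi_ge0// !ltW.
have : expR (- lam * T) * g 0 <= g T.
  apply: (linear_ode_ge dg (T := T)); last by rewrite T0 lexx.
  move=> q /andP[q0 qT]; rewrite addr_ge0// mulr_ge0 ?x_ge0 ?xi_ge0// !ltW//.
by move=> /le_trans/(_ gT); rewrite leNgt mulr_gt0 ?expR_gt0.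
Qed.

End calculus.

(** * The matrix exponential, entry by entry *)
Section matrix_exponential.
Variable R : realType.

Lemma cvg_mx_entries m n (u : nat -> 'M[R]_(m, n)) (L : 'M[R]_(m, n)) :
  (forall i j, (fun k => u k i j) @ \oo --> L i j) -> u @ \oo --> L.
Proof.
move=> u_L; apply/cvg_ballP => e e0.
have : \forall k \near \oo, forall ij : 'I_m * 'I_n,
    ball (L ij.1 ij.2) e (u k ij.1 ij.2).
  by apply: filter_forall => -[i j]; move/cvg_ballP: (u_L i j); exact.
by apply: filterS => k u_k; split=> // i j; exact: (u_k (i, j)).
Qed.

Variables (n : nat) (A : 'M[R]_n).
Implicit Types (i j l : 'I_n) (p k : nat) (t : R).

(** The sum of the absolute values of all entries is submultiplicative, which
    makes every entry of the exponential series an entire power series. *)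
Lemma mxpow_entry_le :
  exists2 M : R, 0 <= M & forall k i j, `|(A ^+ k) i j| <= M ^+ k.
Proof.
pose M := \sum_i \sum_j `|A i j|; exists M; first by do 2 apply: sumr_ge0 => ? _.
elim=> [|k IHk] i j.
  by rewrite !expr0 mxE; case: eqP => _; rewrite ?normr1 ?normr0 ?ler01.
rewrite !exprS mxE (le_trans (ler_norm_sum _ _ _))//.
apply: (@le_trans _ _ (\sum_l `|A i l| * M ^+ k)).
  by apply: ler_sum => l _; rewrite normrM ler_wpM2l.
rewrite -mulr_suml ler_wpM2r ?exprn_ge0 ?(le_trans (normr_ge0 _) (IHk i j))//.
  by do 2 apply: sumr_ge0 => ? _.
rewrite [leRHS](bigD1 i)//= lerDl.
by apply: sumr_ge0 => *; apply: sumr_ge0.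
Qed.

Lemma scalemx_exp t k : (t *: A) ^+ k = t ^+ k *: A ^+ k.
Proof.
elim: k => [|k IHk]; first by rewrite !expr0 scale1r.
rewrite !exprS IHk -[LHS]/((t *: A) *m (t ^+ k *: A ^+ k)).
by rewrite -scalemxAl -scalemxAr scalerA.
Qed.

(** The shift p accounts for differentiation: deriving the power series with
    coefficients A^(k + p) / k! raises p by one. *)
Definition expmx_coef p i j k : R := (k`!%:R)^-1 * (A ^+ (k + p)) i j.

Lemma cvg_expmx_coef p i j t : cvgn (pseries (expmx_coef p i j) t).
Proof.
have [M M0 AM] := mxpow_entry_le.
apply: normed_cvg.
apply: (@series_le_cvg _ _ (M ^+ p *: exp_coeff (M * `|t|))).
- by move=> k /=.
- by move=> k; rewrite mulr_ge0 ?exprn_ge0 ?exp_coeff_ge0 ?mulr_ge0.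
- move=> k.
  have -> : (M ^+ p *: exp_coeff (M * `|t|)) k =
     (k`!%:R)^-1 * M ^+ (k + p) * `|t| ^+ k.
    by rewrite fctE /GRing.scale/= /exp_coeff/= exprMn exprD; ring.
  rewrite /= /expmx_coef !normrM normfV normr_nat normrX.
  by rewrite ler_wpM2r ?exprn_ge0// ler_wpM2l.
- by apply: is_cvg_seriesZ; exact: is_cvg_series_exp_coeff.
Qed.

Lemma pseries_diffs_expmx_coef p i j :
  pseries_diffs (expmx_coef p i j) = expmx_coef p.+1 i j.
Proof.
apply/funext => k; rewrite /pseries_diffs /expmx_coef factS natrM invfM.
by rewrite addnS addSn mulrA mulVKf.
Qed.

Lemma expmx_entry i j t :
  expmx (t *: A) i j = limn (pseries (expmx_coef 0 i j) t).
Proof.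
have entry k i' j' : series (fun k => (k`!%:R)^-1 *: (t *: A) ^+ k) k i' j' =
    pseries (expmx_coef 0 i' j') t k.
  rewrite /pseries /series/= summxE; apply: eq_bigr => q _.
  rewrite /expmx_coef addn0 mxE -mulrA; congr (_ * _).
  by rewrite scalemx_exp mxE mulrC.
pose E := \matrix_(i', j') limn (pseries (expmx_coef 0 i' j') t).
suff : series (fun k => (k`!%:R)^-1 *: (t *: A) ^+ k) @ \oo --> E.
  by move/cvg_lim; rewrite /expmx => -> //; rewrite mxE.
apply: cvg_mx_entries => i' j'; rewrite mxE.
under eq_cvg do rewrite entry.
exact: cvg_expmx_coef.
Qed.

Lemma expmx0_entry i j : expmx (0 *: A) i j = (i == j)%:R.
Proof.
rewrite expmx_entry; apply/cvg_lim => //.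
rewrite -cvg_shiftS /=.
suff -> : (fun k => pseries (expmx_coef 0 i j) 0 k.+1) = cst (i == j)%:R.
  exact: cvg_cst.
apply/funext => k; rewrite /pseries /series/= big_nat_recl//= big1 ?addr0.
  by rewrite /expmx_coef fact0 invr1 mul1r mulr1 addn0 expr0 mxE.
by move=> q _; rewrite expr0n mulr0.
Qed.

Lemma is_derive_expmx_entry i j t :
  is_derive t 1 (fun x => expmx (x *: A) i j)
                (\sum_l A i l * expmx (t *: A) l j).
Proof.
have -> : (fun x => expmx (x *: A) i j) =
    (fun x => limn (pseries (expmx_coef 0 i j) x)).
  by apply/funext => x; rewrite expmx_entry.
apply: is_derive_eq.
  apply: (@pseries_snd_diffs _ _ (`|t| + 1));
    rewrite ?pseries_diffs_expmx_coef; try exact: cvg_expmx_coef.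
  by rewrite [ltRHS]ger0_norm ?addr_ge0// ltrDl.
rewrite pseries_diffs_expmx_coef.
apply/cvg_lim => //.
under eq_bigr do rewrite expmx_entry.
have -> : pseries (expmx_coef 1 i j) t =
    (fun k => \sum_l A i l * pseries (expmx_coef 0 l j) t k).
  apply/funext => k; rewrite /pseries /series/=.
  under [RHS]eq_bigr do rewrite mulr_sumr.
  rewrite exchange_big/=; apply: eq_bigr => q _.
  rewrite /expmx_coef addn1 addn0 exprS mxE mulr_sumr mulr_suml.
  by apply: eq_bigr => l _; ring.
apply: cvg_big => [|l _]; first exact: add_continuous.
apply: cvgM; first exact: cvg_cst.
exact: cvg_expmx_coef.
Qed.

End matrix_exponential.

(** * Non-negativity of the CARMA kernel and process *)
Lemma monic_quadratic_coef (K : comNzRingType) (z1 z2 : K) :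
  (('X - z1%:P) * ('X - z2%:P))`_0 = z1 * z2 /\
  (('X - z1%:P) * ('X - z2%:P))`_1 = - (z1 + z2).
Proof. by rewrite mulrBl !coefE/=; split; ring. Qed.

Section carma_kernel.
Variable R : realType.
Implicit Types (P Q S : {poly R}) (b t : R).

Lemma horner_size2 S b : (size S <= 2)%N -> S.[b] = S`_0 + S`_1 * b.
Proof.
move=> sS; rewrite (horner_coef_wide _ sS) !big_ord_recl big_ord0/= /bump/=; ring.
Qed.

(** The last column of the exponential of the companion matrix is (x, x', x'')
    for the solution x of P(D) x = 0 with initial data (0, 0, 1). *)
Lemma carma_kernel_ode P Q : size P = 4%N -> P \is monic ->
  exists x0 x1 x2 : R -> R,
    [/\ forall t, is_derive t 1 x0 (x1 t),
        forall t, is_derive t 1 x1 (x2 t),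
        forall t, is_derive t 1 x2 (- P`_0 * x0 t - P`_1 * x1 t - P`_2 * x2 t),
        [/\ x0 0 = 0, x1 0 = 0 & x2 0 = 1] &
        forall t, carma_kernel P Q t = Q`_0 * x0 t + Q`_1 * x1 t + Q`_2 * x2 t].
Proof.
move=> sP mP; rewrite /carma_kernel.
have := erefl (companionmx P).
rewrite {2}/companionmx; move: (companionmx P).
have -> : (size P).-1 = 3%N by rewrite sP.
move=> A defA.
have {defA} AE i j : A i j =
    if i == 2%N :> nat then - P`_j else (i.+1 == j :> nat)%:R.
  by rewrite defA mxE.
pose i0 : 'I_3 := ord0; pose i1 : 'I_3 := lift ord0 ord0.
pose i2 : 'I_3 := lift ord0 (lift ord0 ord0).
pose x (i : 'I_3) t := expmx (t *: A) i i2.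
exists (x i0), (x i1), (x i2); split.
- move=> t; apply: is_derive_eq (is_derive_expmx_entry A i0 i2 t) _.
  by rewrite !big_ord_recl big_ord0 !AE/= /x; ring.
- move=> t; apply: is_derive_eq (is_derive_expmx_entry A i1 i2 t) _.
  by rewrite !big_ord_recl big_ord0 !AE/= /x; ring.
- move=> t; apply: is_derive_eq (is_derive_expmx_entry A i2 i2 t) _.
  rewrite !big_ord_recl big_ord0 !AE/= /x /bump/=; ring.
- by rewrite /x !expmx0_entry.
- move=> t; rewrite mxE !big_ord_recl big_ord0 !mxE/=.
  rewrite !mulr0 !add0r addr0 mulr1 !big_ord_recl big_ord0 !mxE/= /x /bump/=.
  by rewrite addr0 addrA.
Qed.

(** In the unknowns g = Q(D) x, xi = (D - b1) x and x, the equation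
    P(D) x = 0 becomes (D + lam) g = S(D) x = S(b1) x + s1 xi, because
    S(z) = S(b1) + s1 (z - b1). *)
Lemma carma_kernel_ge0 P Q S (lam b1 b2 : R) : size P = 4%N -> P \is monic ->
  Q = ('X - b1%:P) * ('X - b2%:P) ->
  S = ('X + lam%:P) * Q - P -> (size S <= 2)%N ->
  0 <= S.[b1] -> 0 <= S`_1 ->
  forall t, 0 <= t -> 0 <= carma_kernel P Q t.
Proof.
move=> sP mP defQ defS sS Sb1 S1 t t0.
have [x0 [x1 [x2 [dx0 dx1 dx2 [x00 x10 x20] kE]]]] := carma_kernel_ode Q sP mP.
have [] := monic_quadratic_coef b1 b2; rewrite -defQ => Q0 Q1.
have Q2 : Q`_2 = 1 by rewrite defQ mulrBl !coefE/=; ring.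
have Sk k : S`_k = (if k is k'.+1 then Q`_k' else 0) + lam * Q`_k - P`_k.
  by rewrite defS coefB mulrDl coefD coefXM coefCM; case: k.
have S2 : S`_2 = 0 by rewrite nth_default.
have P0 : P`_0 = lam * Q`_0 - S`_0 by rewrite Sk/=; ring.
have P1 : P`_1 = Q`_0 + lam * Q`_1 - S`_1 by rewrite Sk/=; ring.
have P2 : P`_2 = Q`_1 + lam * Q`_2.
  by move: S2; rewrite Sk/= => /eqP; rewrite subr_eq0 => /eqP <-.
have Sh := horner_size2 b1 sS.
pose g (s : R) : R := Q`_0 * x0 s + Q`_1 * x1 s + Q`_2 * x2 s.
pose xi (s : R) : R := x1 s - b1 * x0 s.
have dg (s : R) : is_derive s 1 g (- lam * g s + (S.[b1] * x0 s + S`_1 * xi s)).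
  apply: is_derive_eq (is_derive_addf (is_derive_addf
    (is_derive_scalef Q`_0 (dx0 s)) (is_derive_scalef Q`_1 (dx1 s)))
    (is_derive_scalef Q`_2 (dx2 s))) _.
  rewrite /g /xi P0 P1 P2 Q0 Q1 Q2 Sh; ring.
have dxi (s : R) : is_derive s 1 xi (b2 * xi s + g s).
  apply: is_derive_eq (is_deriveB (dx1 s) (is_derive_scalef b1 (dx0 s))) _.
  rewrite /g /xi Q0 Q1 Q2; ring.
have dx (s : R) : is_derive s 1 x0 (b1 * x0 s + xi s).
  by apply: is_derive_eq (dx0 s) _; rewrite /xi; ring.
have g0 : 0 < g 0 by rewrite /g x00 x10 x20 Q2; lra.
have xi0 : 0 <= xi 0 by rewrite /xi x00 x10; lra.
have x0_ge0 : 0 <= x0 0 by rewrite x00.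
by rewrite kE; exact: (cascade_ge0 Sb1 S1 dg dxi dx g0 xi0 x0_ge0 t0).
Qed.

End carma_kernel.

Section carma_process.
Variable R : realType.

(** The bound holds on every path: where the path is not a cumulative function,
    the integral is zero by convention. *)
Lemma carma_ge0 (Omega : Type) (P Q : {poly R}) (L : R -> Omega -> R) t omega :
  (forall s, 0 <= s -> 0 <= carma_kernel P Q s) -> 0 <= carma P Q L t omega.
Proof.
move=> k_ge0; rewrite /carma /stieltjes_integral; case: pselect => // exG.
by apply: Rintegral_ge0 => s /=; rewrite in_itv/= => st; rewrite k_ge0 ?subr_ge0.
Qed.

End carma_process.

(** * The Fejer kernel *)
Section fejer_kernel.
Variable R : realType.
Local Notation mu := (@lebesgue_measure R).
Implicit Types (f F h : R -> R) (a b s t x y : R).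

Lemma integral_FTC2 f F a b : a < b ->
  (forall t, is_derive t 1 F (f t)) -> continuous f ->
  (\int[mu]_(t in `[a, b]) (f t)%:E = (F b - F a)%:E)%E.
Proof.
move=> ab dF cf; have cF := is_derive_continuous dF.
rewrite (@continuous_FTC2 _ f F)//; first exact: continuous_subspaceT.
- split; first by move=> t _; case: (dF t).
  + by apply: cvg_at_right_filter; exact: cF.
  + by apply: cvg_at_left_filter; exact: cF.
- by move=> t _; rewrite derive1E (@derive_val _ _ _ _ _ _ _ (dF t)).
Qed.

Lemma continuous_integrable_segment f a b : continuous f ->
  mu.-integrable `[a, b] (EFin \o f).
Proof.
move=> cf; apply: continuous_compact_integrable.
- exact: segment_compact.
- exact: continuous_subspaceT.
Qed.

(** The Fejer kernel as a superposition of cosines; its closed form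
    (1 - cos (s a)) / s^2 is only valid away from s = 0. *)
Definition fejer a s : R := \int[mu]_(y in `[0, a]) ((a - y) * cos (s * y)).

Lemma is_derive_fejer_weight a y : is_derive y 1 (fun z => a - z) (- 1 : R).
Proof.
apply: is_derive_eq (is_deriveB (is_derive_cst a y 1) (is_derive_id y 1)) _.
by rewrite sub0r.
Qed.

Lemma continuous_fejer_integrand a s :
  continuous (fun y => (a - y) * cos (s * y)).
Proof.
exact: is_derive_continuous (fun y => is_derive_mulf
  (is_derive_fejer_weight a y) (is_derive_cosM s y)).
Qed.

Lemma fejerE a s : 0 < a -> s != 0 -> fejer a s = (1 - cos (s * a)) / s ^+ 2.
Proof.
move=> a0 s0.
pose F y : R := (a - y) * (s^-1 * sin (s * y)) - s ^- 2 * cos (s * y).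
have dF y : is_derive y 1 F ((a - y) * cos (s * y)).
  apply: is_derive_eq (is_deriveB (is_derive_mulf (is_derive_fejer_weight a y)
    (is_derive_scalef s^-1 (is_derive_sinM s y)))
    (is_derive_scalef (s ^- 2) (is_derive_cosM s y))) _.
  by field.
rewrite /fejer /Rintegral (integral_FTC2 a0 dF (@continuous_fejer_integrand a s)).
by rewrite /F/= mulr0 cos0 sin0; field.
Qed.

Lemma cos1_le t : 0 <= t <= 1 -> cos 1 <= cos t :> R.
Proof.
move=> /andP[t0 t1].
have p1 : 1 <= pi :> R by rewrite (le_trans _ (pi_ge2 R))// ler1n.
by rewrite leNgt ltr_cos ?in_itv/= -?leNgt// ?ler01 ?t0/= ?(le_trans t1).
Qed.

(** For |s| <= 1 / a all the cosines of the superposition are at least cos 1: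
    the kernel has height of order a^2 on an interval of length 2 / a. *)
Lemma fejer_peak a s : 0 < a -> `|s| * a <= 1 ->
  cos 1 * (a ^+ 2 / 2) <= fejer a s.
Proof.
move=> a0 sa.
pose F y : R := cos 1 * (a * y - 2^-1 * (y * y)).
have dF y : is_derive y 1 F ((a - y) * cos 1).
  apply: is_derive_eq (is_derive_scalef (cos 1) (is_deriveB (is_derive_line a y)
     (is_derive_scalef 2^-1
       (is_derive_mulf (is_derive_id y 1) (is_derive_id y 1))))) _.
  by field.
have cw : continuous (fun y => (a - y) * cos 1).
  exact: is_derive_continuous (fun y => is_derive_mulf
    (is_derive_fejer_weight a y) (is_derive_cst (cos 1) y 1)).
have -> : cos 1 * (a ^+ 2 / 2) = \int[mu]_(y in `[0, a]) ((a - y) * cos 1).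
  by rewrite /Rintegral (integral_FTC2 a0 dF cw) /F/=; field.
apply: le_Rintegral => //.
- exact: continuous_integrable_segment.
- by apply: continuous_integrable_segment; exact: continuous_fejer_integrand.
move=> y /=; rewrite in_itv/= => /andP[y0 ya].
rewrite ler_wpM2l ?subr_ge0// -(cos_norm (s * y)) cos1_le// normr_ge0/= normrM.
by rewrite (le_trans _ sa)// ler_wpM2l// ger0_norm.
Qed.

Lemma fejer_ge0 a s : 0 < a -> 0 <= fejer a s.
Proof.
move=> a0; have [->|s0] := eqVneq s 0.
  apply: le_trans (fejer_peak a0 _); last by rewrite normr0 mul0r.
  by rewrite mulr_ge0 ?ltW ?cos1_gt0 ?divr_gt0 ?exprn_gt0.
by rewrite fejerE// mulr_ge0 ?invr_ge0 ?sqr_ge0// subr_ge0 cos_le1.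
Qed.

(** Away from the origin the kernel is bounded independently of a. *)
Lemma fejer_tail a d s : 0 < a -> 0 < d -> d <= `|s| ->
  fejer a s <= 2 / d ^+ 2.
Proof.
move=> a0 d0 ds.
have s0 : s != 0 by rewrite -normr_gt0 (lt_le_trans d0).
rewrite fejerE// ler_pM ?subr_ge0 ?cos_le1 ?invr_ge0 ?sqr_ge0//.
  by rewrite lerBlDr -lerBlDl; have := cos_geN1 (s * a); lra.
rewrite -[s ^+ 2]real_normK ?num_real// lef_pV2 ?posrE ?exprn_gt0//.
  by rewrite lerXn2r// nnegrE ltW.
by rewrite (lt_le_trans d0).
Qed.

End fejer_kernel.

(** * Injectivity of the Fourier transform on the half-line *)
Section fejer_average.
Variable R : realType.
Local Notation mu := (@lebesgue_measure R).
Local Notation RT := (measurableTypeR R).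
Implicit Types (h : R -> R) (a s t x y : R).

(** The average of h against the kernel is a superposition of the vanishing
    integrals of h(t) cos ((t - x) y); the order of integration is exchanged
    for the functions extended by zero to the whole line. *)
Lemma integral_fejer (D : set R) h a x : measurable D ->
  mu.-integrable D (EFin \o h) ->
  (forall y, \int[mu]_(t in D) (h t * cos ((t - x) * y)) = 0) ->
  mu.-integrable D (fun t => (h t * fejer a (t - x))%:E) /\
  \int[mu]_(t in D) (h t * fejer a (t - x)) = 0.
Proof.
move=> mD hD h0.
pose H : R -> R := h \_ D.
pose k : R -> R := (fun y => a - y) \_ `[0, a].
have iH : mu.-integrable [set: RT] (EFin \o H).
  by rewrite /H -restrict_EFin -integrable_mkcond.
have ik : mu.-integrable [set: RT] (EFin \o k).
  rewrite /k -restrict_EFin; apply: (integrable_mkcond _ _).1 => //.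
  apply: continuous_integrable_segment.
  exact: is_derive_continuous (is_derive_fejer_weight a).
have mH : measurable_fun [set: RT] H.
  by apply/measurable_EFinP; case/integrableP: iH.
have mk : measurable_fun [set: RT] k.
  by apply/measurable_EFinP; case/integrableP: ik.
have mcos s : measurable_fun [set: RT] (fun y : R => cos (s * y)).
  apply: continuous_measurable_fun.
  exact: is_derive_continuous (is_derive_cosM s).
have ikcos s : mu.-integrable [set: RT] (fun y => (k y * cos (s * y))%:E).
  apply: (le_integrable _ _ _ ik) => //.
    by apply/measurable_EFinP; apply: measurable_funM; [exact: mk|exact: mcos].
  by move=> y _; rewrite lee_fin/= normrM ler_piMr// cos_max.
pose G (z : RT * RT) := (H z.1 * (k z.2 * cos ((z.1 - x) * z.2)))%:E.
have mG : measurable_fun [set: RT * RT] G.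
  apply/measurable_EFinP; apply: measurable_funM.
    exact: (measurableT_comp mH measurable_fst).
  apply: measurable_funM; first exact: (measurableT_comp mk measurable_snd).
  apply: measurableT_comp.
    by apply: continuous_measurable_fun; exact: continuous_cos.
  apply: measurable_funM => //.
  by apply: measurable_funB.
have iG : (mu \x mu)%E.-integrable [set: RT * RT] G.
  apply/integrable12ltyP => //.
  pose C := (\int[mu]_y `|(k y)%:E|)%E.
  have Cfin : C \is a fin_num.
    by rewrite ge0_fin_numE ?integral_ge0//; case/integrableP: ik.
  apply: (@le_lt_trans _ _ (\int[mu]_t (`|(H t)%:E| * C))%E).
    apply: ge0_le_integral => //.
    - by move=> t _; exact: integral_ge0.
    - apply: (measurable_fun_fubini_tonelli_F (abse \o G)) => //=.
      exact: measurableT_comp.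
    - apply: emeasurable_funM => //.
      by apply: measurableT_comp => //; exact/measurable_EFinP.
    move=> t _; rewrite -ge0_integralZl//; last first.
      by apply: measurableT_comp => //; exact/measurable_EFinP.
    apply: ge0_le_integral => //.
    - apply: measurableT_comp => //.
      exact: measurableT_comp mG (pair1_measurable t).
    - apply: emeasurable_funM => //.
      by apply: measurableT_comp => //; exact/measurable_EFinP.
    move=> y _; rewrite -EFinM lee_fin !normrM ler_wpM2l//.
    by rewrite ler_piMr// cos_max.
  rewrite -(fineK Cfin) ge0_integralZr//; last 2 first.
  - by apply: measurableT_comp => //; exact/measurable_EFinP.
  - by rewrite lee_fin fine_ge0// integral_ge0.
  case/integrableP: (iH) => _ iH'; rewrite lte_mul_pinfty ?integral_ge0//.
    by rewrite ge0_fin_numE ?integral_ge0.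
  by rewrite ltry.
have inner t : (\int[mu]_y G (t, y) = (H t * fejer a (t - x))%:E)%E.
  transitivity (\int[mu]_y ((H t)%:E * (k y * cos ((t - x) * y))%:E))%E.
    by apply: eq_integral => y _; rewrite -EFinM.
  rewrite integralZl// EFinM; congr (_ * _)%E.
  rewrite /fejer /Rintegral fineK.
    rewrite [RHS]integral_mkcond; apply: eq_integral => y _.
    by rewrite /k !patchE; case: ifP => // _; rewrite mul0r.
  apply: integrable_fin_num => //.
  by apply: continuous_integrable_segment; exact: continuous_fejer_integrand.
have outer y : (\int[mu]_t G (t, y) = 0)%E.
  have ihcos : mu.-integrable D (fun t => (h t * cos ((t - x) * y))%:E).
    apply: (le_integrable _ _ _ hD) => //.
      apply/measurable_EFinP; apply: measurable_funM.
        by apply/measurable_EFinP; case/integrableP: hD.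
      apply: measurable_funTS; apply: measurableT_comp => //.
        by apply: continuous_measurable_fun; exact: continuous_cos.
      by apply: measurable_funM => //; exact: measurable_funB.
    by move=> t _; rewrite lee_fin/= normrM ler_piMr// cos_max.
  transitivity (\int[mu]_(t in D) ((k y)%:E * (h t * cos ((t - x) * y))%:E))%E.
    rewrite [RHS]integral_mkcond; apply: eq_integral => t _.
    rewrite /G /H/= !patchE; case: ifP => _; last by rewrite mul0r.
    by rewrite -EFinM; congr EFin; ring.
  rewrite integralZl//.
  have := h0 y; rewrite /Rintegral => h0y.
  have mDT : measurable (D : set RT) by [].
  by rewrite -(fineK (integrable_fin_num mDT ihcos)) h0y mule0.
have HK : (fun t => (h t * fejer a (t - x))%:E) \_ D =
    (fun t => (H t * fejer a (t - x))%:E).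
  by apply/funext => t; rewrite /H !patchE; case: ifP => // _; rewrite mul0r.
split.
  rewrite integrable_mkcond// HK.
  have := integrable_fubini_F iG; rewrite /fubini_F.
  by under eq_fun do rewrite inner.
rewrite /Rintegral integral_mkcond HK.
under eq_integral do rewrite -inner.
rewrite Fubini//.
under eq_integral do rewrite outer.
by rewrite integral0.
Qed.

End fejer_average.

Section fourier_injectivity.
Variable R : realType.
Local Notation mu := (@lebesgue_measure R).
Local Notation RT := (measurableTypeR R).
Implicit Types (h : R -> R) (x y t : R).

(** If h(x) > 0, then h >= h(x) / 2 within some distance d of x, and the average
    of h against the kernel centred at x is at least a constant times a (from
    [x, x + 1 / a]) minus 2 / d^2 times the integral of |h| (from the points at
    distance at least d).  It cannot vanish for large a.  The one-sided interval
    [x, x + 1 / a] makes the argument work at the endpoint 0 too. *)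
Lemma fourier_vanish_le0 h : {within `[0, +oo[, continuous h} ->
  mu.-integrable `[0, +oo[ (EFin \o h) ->
  (forall x y, \int[mu]_(t in `[0, +oo[) (h t * cos ((t - x) * y)) = 0) ->
  forall x, 0 <= x -> h x <= 0.
Proof.
move=> ch ih h0 x x0; rewrite leNgt; apply/negP => c0.
set D := `[0, +oo[%classic in ch ih h0.
have mD : measurable (D : set RT) by exact: measurable_itv.
have [d d0 hd] : exists2 d, 0 < d &
    forall t, 0 <= t -> `|x - t| < d -> h x / 2 <= h t.
  have Dx : D x by rewrite /D/= in_itv/= x0.
  have /cvgrPdist_lt/(_ (h x / 2)) := (subspace_continuousP _ _).1 ch x Dx.
  move=> /(_ (divr_gt0 c0 (ltr0Sn _ _))) /nbhs_ballP[d /= d0 hd].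
  exists d => // t t0 xt; have := hd t xt; rewrite /D/= in_itv/= t0 => /(_ isT).
  rewrite ltr_norml => /andP[_ hxt].
  by have {hxt}: h x - h t < h x / 2 := hxt; lra.
pose N := \int[mu]_(t in D) `|h t|.
have N0 : 0 <= N by exact: Rintegral_ge0.
pose k := cos 1 : R; have k0 : 0 < k by exact: cos1_gt0.
(* a is chosen so that the peak fits in the d-neighbourhood and outweighs the
   tail. *)
have [a [a0 ad aN]] : exists a,
    [/\ 0 < a, a^-1 < d & 2 / d ^+ 2 * N < h x / 2 * (k * (a ^+ 2 / 2)) * a^-1].
  have : 0 <= 8 * N / (d ^+ 2 * h x * k).
    by rewrite divr_ge0 ?mulr_ge0// ?ltW// exprn_gt0.
  have : 0 < d^-1 by rewrite invr_gt0.
  set u := d^-1; move E : (8 * N / _) => q u0 q0.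
  have a0 : 0 < u + q + 1 by rewrite addr_gt0// ltr_wpDr.
  exists (u + q + 1); split => //.
    by rewrite -[ltRHS]invrK ltf_pV2 ?posrE// -addrA ltrDl ltr_wpDl.
  have -> : 2 / d ^+ 2 * N = h x * k / 4 * q.
    by rewrite -E; field; rewrite !gt_eqF.
  have -> : h x / 2 * (k * ((u + q + 1) ^+ 2 / 2)) * (u + q + 1)^-1 =
      h x * k / 4 * (u + q + 1) by field; rewrite gt_eqF.
  rewrite ltr_pM2l; last by rewrite divr_gt0// mulr_gt0.
  by rewrite addrAC ltrDr addr_gt0.
have [iK K0] := integral_fejer a mD ih (h0 x).
pose M := h x / 2 * (k * (a ^+ 2 / 2)).
have M0 : 0 <= M by rewrite !mulr_ge0// ?ltW.
(* l is an integrable lower bound for the averaged function. *)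
pose l t : R := M * \1_`[x, x + a^-1] t - 2 / d ^+ 2 * `|h t|.
have iI : mu.-integrable D (fun t => (\1_`[x, x + a^-1] t)%:E).
  have := @integrable_indic_itv R x (x + a^-1) true false.
  by apply: integrableS.
have iN : mu.-integrable D (fun t => `|h t|%:E) by exact: integrable_norm.
have iMI : mu.-integrable D (fun t => (M * \1_`[x, x + a^-1] t)%:E).
  by under eq_fun do rewrite EFinM; exact: integrableZl.
have idN : mu.-integrable D (fun t => (2 / d ^+ 2 * `|h t|)%:E).
  by under eq_fun do rewrite EFinM; exact: integrableZl.
have il : mu.-integrable D (EFin \o l).
  have -> : EFin \o l = ((fun t => (M * \1_`[x, x + a^-1] t)%:E) \-
      (fun t => (2 / d ^+ 2 * `|h t|)%:E))%E by [].
  exact: integrableB.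
have : \int[mu]_(t in D) l t <= \int[mu]_(t in D) (h t * fejer a (t - x)).
  apply: le_Rintegral => // t; rewrite /D/= in_itv/= andbT => t0.
  have f0 := fejer_ge0 (t - x) a0.
  have tail0 : 0 <= 2 / d ^+ 2 * `|h t|.
    by rewrite mulr_ge0// divr_ge0// sqr_ge0.
  rewrite /l indicE; have [xt|xt] := ltP `|x - t| d.
    have hx := hd _ t0 xt.
    have [|_] := boolP (t \in _); last first.
      have ht0 : 0 <= h t by rewrite (le_trans _ hx)// divr_ge0// ltW.
      by rewrite mulr0; have := mulr_ge0 ht0 f0; lra.
    rewrite inE/= in_itv/= => /andP[xt0 xta].
    have := @fejer_peak _ a (t - x) a0.
    rewrite ger0_norm ?subr_ge0// -ler_pdivlMr// div1r lerBlDl => /(_ xta) pk.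
    rewrite mulr1; apply: le_trans (_ : M <= _); first by rewrite lerBlDr lerDl.
    by rewrite /M ler_pM// ?mulr_ge0 ?ltW//.
  have [|] := boolP (t \in _).
    rewrite inE/= in_itv/= => /andP[xt0 xta]; exfalso.
    move: xt; rewrite distrC ger0_norm ?subr_ge0//; lra.
  move=> _; rewrite mulr0 sub0r lerNl -mulNr [leRHS]mulrC.
  apply: le_trans (_ : `|h t| * fejer a (t - x) <= _).
    by rewrite ler_wpM2r// -normrN ler_norm.
  by rewrite ler_wpM2l// fejer_tail// distrC.
have muI : lebesgue_measure (`[x, x + a^-1]%classic : set R) = (a^-1)%:E.
  rewrite lebesgue_measure_itv/= lte_fin ltrDl invr_gt0 a0.
  by rewrite -EFinB addrC addKr.
rewrite K0; apply/negP; rewrite -ltNge.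
rewrite RintegralB//.
rewrite RintegralZl// RintegralZl// -/N subr_gt0.
suff -> : \int[mu]_(t in D) \1_`[x, x + a^-1] t = a^-1 by [].
rewrite /Rintegral integral_indic//.
rewrite setIidl; last first.
  by move=> t; rewrite /D/= !in_itv/= andbT => /andP[xt _]; exact: le_trans xt.
exact: (congr1 fine muI).
Qed.

(** The addition theorem turns the hypotheses into averages centred at any x, and
    the sign of h can be reversed. *)
Lemma fourier_injective h : {within `[0, +oo[, continuous h} ->
  mu.-integrable `[0, +oo[ (EFin \o h) ->
  (forall y, \int[mu]_(t in `[0, +oo[) (h t * cos (t * y)) = 0) ->
  (forall y, \int[mu]_(t in `[0, +oo[) (h t * sin (t * y)) = 0) ->
  forall x, 0 <= x -> h x = 0.
Proof.
move=> ch ih hcos hsin.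
have mD : measurable (`[0, +oo[%classic : set RT) by exact: measurable_itv.
have bounded (w : R -> R) : measurable_fun [set: RT] w ->
    (forall t, `|w t| <= 1) ->
    mu.-integrable `[0, +oo[ (fun t => (h t * w t)%:E).
  move=> mw w1; apply: (le_integrable _ _ _ ih) => //.
    apply/measurable_EFinP; apply: measurable_funM.
      by apply/measurable_EFinP; case/integrableP: ih.
    exact: measurable_funTS.
  by move=> t _; rewrite lee_fin/= normrM ler_piMr.
have icos y : mu.-integrable `[0, +oo[ (fun t => (h t * cos (t * y))%:E).
  apply: bounded; last by move=> t; exact: cos_max.
  under eq_fun do rewrite mulrC.
  apply: continuous_measurable_fun.
  exact: is_derive_continuous (is_derive_cosM y).
have isin y : mu.-integrable `[0, +oo[ (fun t => (h t * sin (t * y))%:E).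
  apply: bounded; last by move=> t; exact: sin_max.
  under eq_fun do rewrite mulrC.
  apply: continuous_measurable_fun.
  exact: is_derive_continuous (is_derive_sinM y).
have hshift x y : \int[mu]_(t in `[0, +oo[) (h t * cos ((t - x) * y)) = 0.
  transitivity (\int[mu]_(t in `[0, +oo[)
     (cos (x * y) * (h t * cos (t * y)) + sin (x * y) * (h t * sin (t * y)))).
    by apply: eq_Rintegral => t _; rewrite mulrBl cosB; ring.
  rewrite RintegralD//.
  - have -> := RintegralZl (cos (x * y)) mD (icos y).
    have -> := RintegralZl (sin (x * y)) mD (isin y).
    by rewrite [X in _ * X + _](hcos y) [X in _ + _ * X](hsin y) !mulr0 addr0.
  - exact: (integrableZl mD (cos (x * y)) (icos y)).
  - exact: (integrableZl mD (sin (x * y)) (isin y)).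
move=> x x0; apply/eqP; rewrite eq_le; apply/andP; split.
  exact: (fourier_vanish_le0 ch ih hshift x0).
rewrite -oppr_le0; move: x x0; apply: (@fourier_vanish_le0 (fun t => - h t)).
- by move=> t; apply: continuousN; exact: ch.
- exact: (integrableN ih).
- move=> x y.
  have ishift : mu.-integrable `[0, +oo[ (fun t => (h t * cos ((t - x) * y))%:E).
    apply: bounded; last by move=> t; exact: cos_max.
    under eq_fun do rewrite mulrC.
    apply: (measurableT_comp (f := fun t : RT => cos (y * t))).
      apply: continuous_measurable_fun.
      exact: is_derive_continuous (is_derive_cosM y).
    exact: measurable_funB.
  transitivity (\int[mu]_(t in `[0, +oo[) (-1 * (h t * cos ((t - x) * y)))).
    by apply: eq_Rintegral => t _; ring.
  by have -> := RintegralZl (-1) mD ishift; rewrite [X in _ * X]hshift mulr0.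
Qed.

End fourier_injectivity.

(** * Exponentially decaying functions *)
Section exponential_decay.
Variable R : realType.
Local Notation mu := (@lebesgue_measure R).
Local Notation RT := (measurableTypeR R).
Implicit Types (f F w : R -> R) (a b c K t y : R).

Definition exp_decay w :=
  exists2 c, 0 < c & exists K, forall t, 0 <= t -> `|w t| <= K * expR (- c * t).

Lemma exp_decayD f w : exp_decay f -> exp_decay w ->
  exp_decay (fun t => f t + w t).
Proof.
move=> [c c0 [K fK]] [c' c'0 [K' wK']].
have K0 : 0 <= K.
  by have := fK 0 (lexx 0); rewrite mulr0 expR0 mulr1; exact: le_trans.
have K'0 : 0 <= K'.
  by have := wK' 0 (lexx 0); rewrite mulr0 expR0 mulr1; exact: le_trans.
exists (Num.min c c'); first by rewrite lt_min c0.
exists (K + K') => t t0; rewrite (le_trans (ler_normD _ _))// mulrDl lerD//.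
  rewrite (le_trans (fK t t0))// ler_wpM2l// ler_expR ler_wpM2r// lerN2.
  by rewrite ge_min lexx.
rewrite (le_trans (wK' t t0))// ler_wpM2l// ler_expR ler_wpM2r// lerN2.
by rewrite ge_min lexx orbT.
Qed.

Lemma exp_decay_bounded f w b : exp_decay f -> (forall t, `|w t| <= b) ->
  exp_decay (fun t => f t * w t).
Proof.
move=> [c c0 [K fK]] wb; exists c => //; exists (K * b) => t t0.
by rewrite normrM mulrAC ler_pM// fK.
Qed.

Lemma exp_decayZ f a : exp_decay f -> exp_decay (fun t => a * f t).
Proof.
move=> ef; have -> : (fun t => a * f t) = (fun t => f t * a).
  by apply/funext => t; rewrite mulrC.
exact: (exp_decay_bounded (w := fun=> a) ef (fun=> lexx _)).
Qed.

Lemma exp_decay_expR b : b < 0 -> exp_decay (fun t => expR (b * t)).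
Proof.
move=> b0; exists (- b); first by rewrite oppr_gt0.
by exists 1 => t _; rewrite opprK mul1r ger0_norm// expR_ge0.
Qed.

(** Half of the decay rate absorbs the factor t, as 1 + s <= e^s. *)
Lemma exp_decay_id_expR b : b < 0 -> exp_decay (fun t => t * expR (b * t)).
Proof.
move=> b0; have c0 : 0 < - b / 2 by lra.
exists (- b / 2) => //; exists (- b / 2)^-1 => t t0.
rewrite normrM !ger0_norm ?expR_ge0//.
rewrite ler_pdivlMl//.
have -> : - (- b / 2) * t = - b / 2 * t + b * t by field.
rewrite expRD mulrA ler_wpM2r ?expR_ge0//.
by have := expR_ge1Dx (- b / 2 * t); lra.
Qed.

Lemma exp_decay_integrable f : continuous f -> exp_decay f ->
  mu.-integrable `[0, +oo[ (EFin \o f).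
Proof.
move=> cf [c c0 [K fK]].
have mD : measurable (`[0, +oo[%classic : set RT) by exact: measurable_itv.
have ie : mu.-integrable `[0, +oo[ (EFin \o exponential_pdf c).
  exact: integrableS (integrable_exponential_pdf c0).
apply: (le_integrable _ _ _ (integrableZl mD (K / c) ie)) => //.
  apply/measurable_EFinP; apply: measurable_funTS.
  exact: continuous_measurable_fun.
move=> t /=; rewrite in_itv/= andbT => t0.
rewrite lee_fin exponential_pdfE//.
have -> : K / c * (c * expR (- c * t)) = K * expR (- c * t).
  by field; rewrite gt_eqF.
by rewrite (le_trans (fK t t0))// ler_norm.
Qed.

Lemma exp_decay_cvg0 f : exp_decay f -> f n%:R @[n --> \oo] --> 0.
Proof.
move=> [c c0 [K fK]].
have eK : K * expR (- c) ^+ n @[n --> \oo] --> 0.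
  rewrite -[X in _ --> X](mulr0 K); apply: cvgM; first exact: cvg_cst.
  apply: cvg_expr; rewrite ger0_norm ?expR_ge0// -expR0 ltr_expR; lra.
apply/norm_cvg0P.
apply: (squeeze_cvgr (f := fun=> 0) (h := fun n => K * expR (- c) ^+ n));
  last exact: eK.
  apply: nearW => n; rewrite /= normr_ge0/= (le_trans (fK _ _))//.
  by rewrite expRM_natr.
exact: cvg_cst.
Qed.

(** By domination the integral is the limit of the integrals over [0, n], which
    are F(n) - F(0). *)
Lemma integral_FTC2y f F : (forall t, is_derive t 1 F (f t)) -> continuous f ->
  mu.-integrable `[0, +oo[ (EFin \o f) -> F n%:R @[n --> \oo] --> 0 ->
  \int[mu]_(t in `[0, +oo[) f t = - F 0.
Proof.
move=> dF cf i_f F0.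
pose D : set RT := `[0, +oo[%classic.
have mD : measurable D by exact: measurable_itv.
pose f_ (n : nat) : RT -> R := f \_ `[0, n%:R].
have cvgf : (\int[mu]_(t in D) (f_ n t)%:E)%E @[n --> \oo] -->
    (\int[mu]_(t in D) (f t)%:E)%E.
  apply: (@dominated_cvg _ _ _ mu D mD _ _ (abse \o (EFin \o f))) => //.
  - move=> n; apply/measurable_EFinP/measurable_funTS.
    apply/(measurable_restrictT _ _).1; first exact: measurable_itv.
    by apply: measurable_funTS; exact: continuous_measurable_fun.
  - move=> t; rewrite /D/= in_itv/= andbT => t0.
    apply: cvg_near_cst; near=> n.
    rewrite /f_ patchE ifT// inE/= in_itv/= t0/=.
    near: n; exact: nbhs_infty_ger.
  - exact: integrable_abse.
  - move=> n t _; rewrite lee_fin /f_ patchE.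
    by case: ifP => // _; rewrite normr0.
have valn n : (0 < n)%N ->
    (\int[mu]_(t in D) (f_ n t)%:E = (F n%:R - F 0)%:E)%E.
  move=> n0; rewrite -(integral_FTC2 _ dF cf) ?ltr0n//.
  rewrite [LHS]integral_mkcond [RHS]integral_mkcond.
  apply: eq_integral => t _; rewrite /f_ !patchE.
  case: ifPn => [|tD]; first by case: ifPn.
  rewrite ifF//; apply: contraNF tD; rewrite !inE /D/= !in_itv/= andbT.
  by case/andP.
have cvgF : (\int[mu]_(t in D) (f_ n t)%:E)%E @[n --> \oo] --> (- F 0)%:E.
  apply: (@cvg_trans _ ((F n%:R - F 0)%:E @[n --> \oo])).
    by apply: near_eq_cvg; exists 1%N => // n /= n0; rewrite valn.
  apply: cvg_EFin; first exact: nearW.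
  rewrite -[X in _ --> X]add0r; apply: cvgB => //; exact: cvg_cst.
by rewrite /Rintegral (cvg_unique _ cvgf cvgF).
Unshelve. all: by end_near.
Qed.

End exponential_decay.

(** * Fourier transforms of solutions of linear equations *)
Section fourier_of_ode.
Variable R : realType.
Local Notation mu := (@lebesgue_measure R).
Local Notation RT := (measurableTypeR R).
Implicit Types (t y : R).

Section ode_solution.
Variables (q0 q1 : R) (w w1 : R -> R).
Hypothesis dw : forall t, is_derive t 1 w (w1 t).
Hypothesis dw1 : forall t, is_derive t 1 w1 (- q1 * w1 t - q0 * w t).
Hypothesis ew : exp_decay w.
Hypothesis ew1 : exp_decay w1.

Lemma exp_decayMcos f y : exp_decay f -> exp_decay (fun t => f t * cos (y * t)).
Proof. by move=> ef; apply: exp_decay_bounded ef _ => t; exact: cos_max. Qed.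

Lemma exp_decayMsin f y : exp_decay f -> exp_decay (fun t => f t * sin (y * t)).
Proof. by move=> ef; apply: exp_decay_bounded ef _ => t; exact: sin_max. Qed.

Lemma continuousMcos y : continuous (fun t => w t * cos (y * t)).
Proof.
exact: is_derive_continuous (fun t => is_derive_mulf (dw t) (is_derive_cosM y t)).
Qed.

Lemma continuousMsin y : continuous (fun t => w t * sin (y * t)).
Proof.
exact: is_derive_continuous (fun t => is_derive_mulf (dw t) (is_derive_sinM y t)).
Qed.

Lemma integrableMcos y :
  mu.-integrable `[0, +oo[ (fun t => (w t * cos (y * t))%:E).
Proof.
exact: exp_decay_integrable (@continuousMcos y) (exp_decayMcos y ew).
Qed.

Lemma integrableMsin y :
  mu.-integrable `[0, +oo[ (fun t => (w t * sin (y * t))%:E).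
Proof.
exact: exp_decay_integrable (@continuousMsin y) (exp_decayMsin y ew).
Qed.

Lemma integral_lin_cos_sin y a b :
  \int[mu]_(t in `[0, +oo[) (a * (w t * cos (y * t)) + b * (w t * sin (y * t))) =
  a * \int[mu]_(t in `[0, +oo[) (w t * cos (y * t)) +
  b * \int[mu]_(t in `[0, +oo[) (w t * sin (y * t)).
Proof.
have mD : measurable (`[0, +oo[%classic : set RT) by exact: measurable_itv.
rewrite RintegralD//.
- have -> := RintegralZl a mD (integrableMcos y).
  by have -> := RintegralZl b mD (integrableMsin y).
- exact: (integrableZl mD a (integrableMcos y)).
- exact: (integrableZl mD b (integrableMsin y)).
Qed.

Lemma integral_ode_primitive y a b F :
  (forall t, is_derive t 1 F
     (a * (w t * cos (y * t)) + b * (w t * sin (y * t)))) ->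
  exp_decay F ->
  a * \int[mu]_(t in `[0, +oo[) (w t * cos (y * t)) +
  b * \int[mu]_(t in `[0, +oo[) (w t * sin (y * t)) = - F 0.
Proof.
move=> dF eF; rewrite -integral_lin_cos_sin.
have cf : continuous
    (fun t => a * (w t * cos (y * t)) + b * (w t * sin (y * t))).
  exact: is_derive_continuous (fun t => is_derive_addf
    (is_derive_scalef a (is_derive_mulf (dw t) (is_derive_cosM y t)))
    (is_derive_scalef b (is_derive_mulf (dw t) (is_derive_sinM y t)))).
apply: (integral_FTC2y dF cf); last exact: exp_decay_cvg0.
apply: exp_decay_integrable => //.
apply: exp_decayD; apply: exp_decayZ.
  exact: exp_decayMcos.
exact: exp_decayMsin.
Qed.

(** These are the real and imaginary parts of the identity
    Q(iy) W(y) = (q1 + iy) w(0) + w'(0), where W = C - i Sn is the transform of w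
    and Q(z) = z^2 + q1 z + q0: the function
    - ((q1 + iy) w(t) + w'(t)) e^(-ity) is a primitive of
    Q(iy) w(t) e^(-ity) that vanishes at infinity. *)
Lemma fourier_ode_cos_sin y :
  let C := \int[mu]_(t in `[0, +oo[) (w t * cos (y * t)) in
  let Sn := \int[mu]_(t in `[0, +oo[) (w t * sin (y * t)) in
  (q0 - y ^+ 2) * C + q1 * y * Sn = q1 * w 0 + w1 0 /\
  q1 * y * C + (y ^+ 2 - q0) * Sn = y * w 0.
Proof.
move=> C Sn.
pose g (t : R) : R := q1 * w t + w1 t.
have dg (t : R) : is_derive t 1 g (- q0 * w t).
  apply: is_derive_eq (is_derive_addf (is_derive_scalef q1 (dw t)) (dw1 t)) _.
  ring.
have eg : exp_decay g by apply: exp_decayD => //; exact: exp_decayZ.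
split.
  pose F (t : R) : R := -1 * (g t * cos (y * t) + y * (w t * sin (y * t))).
  have dF (t : R) : is_derive t (1 : R) F
      ((q0 - y ^+ 2) * (w t * cos (y * t)) + q1 * y * (w t * sin (y * t))).
    apply: is_derive_eq (is_derive_scalef (-1) (is_derive_addf
      (is_derive_mulf (dg t) (is_derive_cosM y t))
      (is_derive_scalef y (is_derive_mulf (dw t) (is_derive_sinM y t))))) _.
    rewrite /g; ring.
  have eF : exp_decay F.
    apply: exp_decayZ; apply: exp_decayD; first exact: exp_decayMcos.
    by apply: exp_decayZ; exact: exp_decayMsin.
  rewrite (integral_ode_primitive dF eF).
  by rewrite /F /g mulr0 cos0 sin0; ring.
pose F (t : R) : R := g t * sin (y * t) + - y * (w t * cos (y * t)).
have dF (t : R) : is_derive t (1 : R) F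
    (q1 * y * (w t * cos (y * t)) + (y ^+ 2 - q0) * (w t * sin (y * t))).
  apply: is_derive_eq (is_derive_addf
    (is_derive_mulf (dg t) (is_derive_sinM y t))
    (is_derive_scalef (- y) (is_derive_mulf (dw t) (is_derive_cosM y t)))) _.
  rewrite /g; ring.
have eF : exp_decay F.
  apply: exp_decayD; first exact: exp_decayMsin.
  by apply: exp_decayZ; exact: exp_decayMcos.
rewrite (integral_ode_primitive dF eF).
by rewrite /F /g mulr0 cos0 sin0; ring.
Qed.

End ode_solution.

End fourier_of_ode.

Section fourier_rational.
Variable R : realType.
Local Notation mu := (@lebesgue_measure R).
Local Notation RT := (measurableTypeR R).
Implicit Types (f : R -> R) (t y : R).

Lemma Cintegral_expi f y : mu.-integrable `[0, +oo[ (EFin \o f) ->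
  Cintegral mu `[0, +oo[ (fun t => expi (- (t * y)) * (f t)%:C) =
  (\int[mu]_(t in `[0, +oo[) (f t * cos (t * y)))
  +i* (- \int[mu]_(t in `[0, +oo[) (f t * sin (t * y))).
Proof.
move=> i_f; have mD : measurable (`[0, +oo[%classic : set RT).
  exact: measurable_itv.
have isin : mu.-integrable `[0, +oo[ (fun t => (f t * sin (t * y))%:E).
  apply: (le_integrable _ _ _ i_f) => //.
    apply/measurable_EFinP; apply: measurable_funM.
      by apply/measurable_EFinP; case/integrableP: i_f.
    apply: measurable_funTS; under eq_fun do rewrite mulrC.
    apply: continuous_measurable_fun.
    exact: is_derive_continuous (is_derive_sinM y).
  by move=> t _; rewrite lee_fin/= normrM ler_piMr// sin_max.
rewrite /Cintegral; congr (_ +i* _).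
  by apply: eq_Rintegral => t _ /=; rewrite cosN; ring.
transitivity (\int[mu]_(t in `[0, +oo[) (-1 * (f t * sin (t * y)))).
  by apply: eq_Rintegral => t _ /=; rewrite sinN; ring.
by have -> := RintegralZl (-1) mD isin; rewrite mulN1r.
Qed.

(** The initial data are read off the numerator: (q1 + iy) w(0) + w'(0) must
    be s0 + i s1 y. *)
Lemma fourier_ode_unique (q0 q1 s0 s1 : R) (w w1 f : R -> R) :
  (forall t, is_derive t 1 w (w1 t)) ->
  (forall t, is_derive t 1 w1 (- q1 * w1 t - q0 * w t)) ->
  exp_decay w -> exp_decay w1 ->
  w 0 = s1 -> w1 0 = s0 - q1 * s1 ->
  (forall y, (q0 - y ^+ 2) +i* (q1 * y) != 0) ->
  continuous_with_fourier f
    (fun y => (s0 +i* (s1 * y)) / ((q0 - y ^+ 2) +i* (q1 * y))) ->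
  forall t, 0 <= t -> f t = w t.
Proof.
move=> dw dw1 ew ew1 w0 w10 Q0 [cf i_f Ff] t t0.
have mD : measurable (`[0, +oo[%classic : set RT) by exact: measurable_itv.
have cw := is_derive_continuous dw.
have iw := exp_decay_integrable cw ew.
have coef y : \int[mu]_(t in `[0, +oo[) (f t * cos (t * y)) =
      \int[mu]_(t in `[0, +oo[) (w t * cos (t * y)) /\
    \int[mu]_(t in `[0, +oo[) (f t * sin (t * y)) =
      \int[mu]_(t in `[0, +oo[) (w t * sin (t * y)).
  have comm (g : R -> R) : \int[mu]_(t in `[0, +oo[) (w t * g (t * y)) =
     \int[mu]_(t in `[0, +oo[) (w t * g (y * t)).
    by apply: eq_Rintegral => s _; rewrite (mulrC s).
  have [] := fourier_ode_cos_sin dw dw1 ew ew1 y.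
  rewrite -(comm cos) -(comm sin) w0 w10.
  have := Ff y; rewrite Cintegral_expi//.
  set Cf := Rintegral _ _ _; set Sf := Rintegral _ _ _.
  set Cw := Rintegral _ _ _; set Sw := Rintegral _ _ _ => FfE EC ES.
  have : Cf +i* (- Sf) = Cw +i* (- Sw).
    rewrite FfE; apply: (mulIf (Q0 y)); rewrite divfK//.
    apply/eqP; rewrite eq_complex/=; apply/andP; split; apply/eqP.
      by move: EC; lra.
    by move: ES; lra.
  by case=> -> /oppr_inj.
have diff (g : R -> R) y : (forall s, `|g s| <= 1) ->
    continuous g ->
    \int[mu]_(t in `[0, +oo[) (f t * g (t * y)) =
      \int[mu]_(t in `[0, +oo[) (w t * g (t * y)) ->
    \int[mu]_(t in `[0, +oo[) ((f t - w t) * g (t * y)) = 0.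
  move=> g1 cg fw.
  have ig (v : R -> R) : mu.-integrable `[0, +oo[ (EFin \o v) ->
      mu.-integrable `[0, +oo[ (fun s => (v s * g (s * y))%:E).
    move=> iv; apply: (le_integrable _ _ _ iv) => //.
      apply/measurable_EFinP; apply: measurable_funM.
        by apply/measurable_EFinP; case/integrableP: iv.
      apply: measurable_funTS; apply: (measurableT_comp (f := g)).
        exact: continuous_measurable_fun.
      exact: measurable_funM.
    by move=> s _; rewrite lee_fin/= normrM ler_piMr.
  transitivity (\int[mu]_(t in `[0, +oo[)
     (f t * g (t * y) - w t * g (t * y))).
    by apply: eq_Rintegral => s _; rewrite mulrBl.
  by have -> := RintegralB mD (ig _ i_f) (ig _ iw); rewrite [X in X - _]fw subrr.
apply/eqP; rewrite -subr_eq0; apply/eqP.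
apply: (@fourier_injective R (fun s => f s - w s)) t0.
- move=> s; apply: continuousB; first exact: cf.
  by apply: continuous_subspaceT => r; exact: cw.
- exact: (integrableB mD i_f iw).
- move=> y; apply: diff; [exact: cos_max|exact: continuous_cos|].
  by case: (coef y).
- move=> y; apply: diff; [exact: sin_max|exact: continuous_sin|].
  by case: (coef y).
Qed.

End fourier_rational.

(** * The sign of the function with transform S / Q *)
Section sign_analysis.
Variable R : realType.
Implicit Types (t a b : R).

(** For b1 = b2 the solution is t e^(b2 t); otherwise it is the divided
    difference (e^(b1 t) - e^(b2 t)) / (b1 - b2), which is larger than t e^(b2 t)
    by convexity of the exponential.  Stating the equation and the lower bound
    avoids distinguishing simple and double zeroes later on. *)
Lemma exp_forced_solution b1 b2 : b2 <= b1 -> b1 < 0 ->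
  exists u : R -> R,
    [/\ forall t, is_derive t 1 u (b1 * u t + expR (b2 * t)),
        u 0 = 0, exp_decay u &
        forall t, 0 <= t -> t * expR (b2 * t) <= u t].
Proof.
rewrite le_eqVlt => /predU1P[-> b10|b21 b10].
  exists (fun t => t * expR (b1 * t)); split.
  - move=> t; apply: is_derive_eq
      (is_derive_mulf (is_derive_id t 1) (is_derive_expRM b1 t)) _; ring.
  - by rewrite mul0r.
  - exact: exp_decay_id_expR.
  - by [].
have d0 : 0 < b1 - b2 by rewrite subr_gt0.
exists (fun t => (b1 - b2)^-1 * (expR (b1 * t) + -1 * expR (b2 * t))); split.
- move=> t; apply: is_derive_eq (is_derive_scalef (b1 - b2)^-1 (is_derive_addf
    (is_derive_expRM b1 t) (is_derive_scalef (-1) (is_derive_expRM b2 t)))) _.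
  by field; rewrite gt_eqF.
- by rewrite !mulr0 expR0; ring.
- apply: exp_decayZ; apply: exp_decayD; first exact: exp_decay_expR.
  by apply: exp_decayZ; apply: exp_decay_expR; exact: lt_trans b10.
- move=> t t0; rewrite ler_pdivlMl//.
  have -> : b1 * t = (b1 - b2) * t + b2 * t by ring.
  rewrite expRD -mulrDl mulrA ler_wpM2r ?expR_ge0//.
  by have := expR_ge1Dx ((b1 - b2) * t); lra.
Qed.

(** The function is A u + s1 e^(b2 t), with A the value of s0 + s1 z at b1 and u
    as in [exp_forced_solution]. *)
Lemma fourier_real_ge0 (b1 b2 s0 s1 : R) (f : R -> R) :
  b2 <= b1 -> b1 < 0 ->
  (forall y, (b1 * b2 - y ^+ 2) +i* (- (b1 + b2) * y) != 0) ->
  continuous_with_fourier f (fun y =>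
    (s0 +i* (s1 * y)) / ((b1 * b2 - y ^+ 2) +i* (- (b1 + b2) * y))) ->
  (forall t, 0 <= t -> 0 <= f t) <-> (0 <= s0 + s1 * b1 /\ 0 <= s1).
Proof.
move=> b21 b10 Q0 Ff; set A := s0 + s1 * b1.
have [u [du u0 eu tu]] := exp_forced_solution b21 b10.
pose w t : R := A * u t + s1 * expR (b2 * t).
pose w1 t : R := A * b1 * u t + (A + s1 * b2) * expR (b2 * t).
have dw (t : R) : is_derive t 1 w (w1 t).
  apply: is_derive_eq (is_derive_addf (is_derive_scalef A (du t))
    (is_derive_scalef s1 (is_derive_expRM b2 t))) _.
  rewrite /w1; ring.
have dw1 (t : R) : is_derive t 1 w1 (- - (b1 + b2) * w1 t - b1 * b2 * w t).
  apply: is_derive_eq (is_derive_addf (is_derive_scalef (A * b1) (du t))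
    (is_derive_scalef (A + s1 * b2) (is_derive_expRM b2 t))) _.
  rewrite /w1 /w; ring.
have e2 : exp_decay (fun t => expR (b2 * t)).
  by apply: exp_decay_expR; exact: le_lt_trans b10.
have ew : exp_decay w by apply: exp_decayD; exact: exp_decayZ.
have ew1 : exp_decay w1 by apply: exp_decayD; exact: exp_decayZ.
have w0 : w 0 = s1 by rewrite /w u0 !mulr0 expR0; ring.
have w10 : w1 0 = s0 - - (b1 + b2) * s1 by rewrite /w1 u0 !mulr0 expR0 /A; ring.
have fw := fourier_ode_unique dw dw1 ew ew1 w0 w10 Q0 Ff.
split=> [f0|[A0 s10] t t0]; last first.
  rewrite fw// /w addr_ge0// mulr_ge0 ?expR_ge0//.
  by rewrite (le_trans _ (tu t t0))// mulr_ge0 ?expR_ge0.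
have s10 : 0 <= s1 by rewrite -w0 -fw// f0.
split=> //; rewrite leNgt; apply/negP => A0.
(* Here A t + s1 = - 1, hence A u(t) + s1 e^(b2 t) <= - e^(b2 t). *)
pose t := (s1 + 1) / - A.
have t0 : 0 <= t by rewrite divr_ge0 ?addr_ge0// oppr_ge0 ltW.
have : w t < 0.
  apply: le_lt_trans (_ : A * (t * expR (b2 * t)) + s1 * expR (b2 * t) < 0).
    by rewrite lerD2r ler_wnM2l ?tu// ltW.
  have -> : A * (t * expR (b2 * t)) + s1 * expR (b2 * t) = - expR (b2 * t).
    by rewrite mulrA /t; field; rewrite lt_eqF.
  by rewrite oppr_lt0 expR_gt0.
by rewrite ltNge -fw// f0.
Qed.

(** The function is e^(rt) (al cos (om t) + be sin (om t)); its signs at the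
    phases 0, pi, pi / 2 and 3 pi / 2 would force al = be = 0. *)
Lemma fourier_complex_not_ge0 (r om s0 s1 : R) (f : R -> R) :
  r < 0 -> 0 < om -> (s0 != 0) || (s1 != 0) ->
  (forall y, (r ^+ 2 + om ^+ 2 - y ^+ 2) +i* (- (2 * r) * y) != 0) ->
  continuous_with_fourier f (fun y => (s0 +i* (s1 * y)) /
     ((r ^+ 2 + om ^+ 2 - y ^+ 2) +i* (- (2 * r) * y))) ->
  ~ (forall t, 0 <= t -> 0 <= f t).
Proof.
move=> r0 om0 s_neq0 Q0 Ff.
pose al := s1; pose be := (s1 * r + s0) / om.
pose w t : R := expR (r * t) * (al * cos (om * t) + be * sin (om * t)).
pose w1 t : R := expR (r * t) *
  ((r * al + om * be) * cos (om * t) + (r * be - om * al) * sin (om * t)).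
have dosc (c s t : R) : is_derive t 1
    (fun x => expR (r * x) * (c * cos (om * x) + s * sin (om * x)))
    (expR (r * t) * ((r * c + om * s) * cos (om * t) +
                     (r * s - om * c) * sin (om * t))).
  apply: is_derive_eq (is_derive_mulf (is_derive_expRM r t) (is_derive_addf
    (is_derive_scalef c (is_derive_cosM om t))
    (is_derive_scalef s (is_derive_sinM om t)))) _; ring.
have eosc (c s : R) : exp_decay
    (fun x => expR (r * x) * (c * cos (om * x) + s * sin (om * x))).
  apply: (exp_decay_bounded (b := `|c| + `|s|) (exp_decay_expR r0)) => t.
  rewrite (le_trans (ler_normD _ _))// !normrM lerD// ler_piMr//.
    exact: cos_max.
  exact: sin_max.
have dw (t : R) : is_derive t 1 w (w1 t) := dosc al be t.
have dw1 (t : R) : is_derive t 1 w1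
    (- - (2 * r) * w1 t - (r ^+ 2 + om ^+ 2) * w t).
  by apply: is_derive_eq (dosc _ _ t) _; rewrite /w1 /w; ring.
have w0 : w 0 = s1 by rewrite /w !mulr0 expR0 cos0 sin0 /al; ring.
have w10 : w1 0 = s0 - - (2 * r) * s1.
  by rewrite /w1 !mulr0 expR0 cos0 sin0 /al /be; field; rewrite gt_eqF.
have fw := fourier_ode_unique dw dw1 (eosc _ _) (eosc _ _) w0 w10 Q0 Ff.
move=> f0.
have osc a : 0 <= a -> 0 <= al * cos a + be * sin a.
  move=> a0; have t0 : 0 <= a / om by rewrite divr_ge0// ltW.
  have := f0 _ t0; rewrite fw// /w.
  have -> : om * (a / om) = a by rewrite mulrC divfK ?gt_eqF.
  by rewrite pmulr_rge0 ?expR_gt0.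
have p0 := pi_ge0 R.
have al0 : al = 0.
  have := osc 0 (lexx 0); have := osc pi p0.
  rewrite cospi sinpi cos0 sin0 => h1 h2.
  by apply/eqP; rewrite eq_le; apply/andP; split; lra.
have be0 : be = 0.
  have := osc (pi / 2) (divr_ge0 p0 (ler0n _ 2)).
  have := osc (pi / 2 + pi) (addr_ge0 (divr_ge0 p0 (ler0n _ 2)) p0).
  rewrite cosDpi sinDpi cos_pihalf sin_pihalf => h1 h2.
  by apply/eqP; rewrite eq_le; apply/andP; split; lra.
have s10 : s1 = 0 by exact: al0.
move: be0; rewrite /be s10 mul0r add0r => /eqP.
by rewrite mulf_eq0 invr_eq0 (gt_eqF om0) orbF => s00;
  move: s_neq0; rewrite s10 s00 eqxx.
Qed.

End sign_analysis.

(** * The two conditions in terms of S *)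
Section polynomials.
Variable R : realType.
Implicit Types (P Q S : {poly R}) (b x y : R).

(** P and - S agree at the zeroes of Q, and so do their derivatives at a double
    zero.  The coefficient S_1 is the slope of the affine function S. *)
Lemma carma_conditionsP P Q S (lam b1 b2 : R) :
  Q = ('X - b1%:P) * ('X - b2%:P) -> S = ('X + lam%:P) * Q - P ->
  (size S <= 2)%N -> b2 <= b1 ->
  (b2 < b1 /\ P.[b1] <= Num.min P.[b2] 0) \/
    (b1 = b2 /\ Num.max P.[b1] P^`().[b1] <= 0) <->
  0 <= S.[b1] /\ 0 <= S`_1.
Proof.
move=> defQ defS sS; have PE : P = ('X + lam%:P) * Q - S by rewrite defS; ring.
have Pb b : P.[b] = (b + lam) * ((b - b1) * (b - b2)) - S.[b].
  rewrite PE defQ hornerD hornerN !hornerM hornerD !hornerXsubC.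
  by rewrite hornerX hornerC.
have P1 : P.[b1] = - S.[b1] by rewrite Pb; ring.
have P2 : P.[b2] = - S.[b2] by rewrite Pb; ring.
rewrite le_eqVlt => /predU1P[b21|b21].
  have dP : P^`().[b1] = - S`_1.
    rewrite PE derivB hornerD hornerN [S^`().[b1]](_ : _ = S`_1); last first.
      have -> : S^`() = (S`_1)%:P.
        apply/polyP => -[|i]; rewrite coef_deriv coefC//=.
        by rewrite nth_default ?mul0rn// (leq_trans sS).
      by rewrite hornerC.
    rewrite defQ b21 !derivM !(derivD, derivB) derivX !derivC !hornerD !hornerM.
    by rewrite !(hornerD, hornerM, hornerN, hornerX, hornerC); ring.
  rewrite b21 ltxx dP P1 ge_max !oppr_le0; split=> [[[]//|[_ /andP//]]|[-> ->]].
  by right.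
have SE : S.[b1] - S.[b2] = S`_1 * (b1 - b2) by rewrite !horner_size2//; ring.
have -> : (0 <= S`_1) = (S.[b2] <= S.[b1]).
  by rewrite -[RHS]subr_ge0 SE pmulr_lge0// subr_gt0.
rewrite P1 P2 le_min lerN2 oppr_le0; split=> [[[_ /andP[]]|[e]]|[-> ->]] //.
  by move: b21; rewrite e ltxx.
by left.
Qed.

Lemma horner_Cpoly_imaginary P y : (size P <= 3)%N ->
  (Cpoly P).[0 +i* y] = (P`_0 - P`_2 * y ^+ 2) +i* (P`_1 * y).
Proof.
move=> sP; rewrite (@horner_coef_wide _ 3); last first.
  by rewrite (leq_trans (size_poly _ _)).
rewrite !big_ord_recl big_ord0 /= !coef_map/= /bump/=.
by apply/eqP; rewrite eq_complex/=; apply/andP; split; apply/eqP; ring.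
Qed.

(** The zeroes are both real or conjugate to each other. *)
Lemma real_quadratic_roots (q0 q1 : R) (z1 z2 : R[i]) :
  q0%:C = z1 * z2 -> q1%:C = - (z1 + z2) ->
  [/\ q0 = complex.Re z1 * complex.Re z2 - complex.Im z1 * complex.Im z2,
      q1 = - (complex.Re z1 + complex.Re z2),
      complex.Im z2 = - complex.Im z1 &
      complex.Im z1 != 0 -> complex.Re z2 = complex.Re z1].
Proof.
case: z1 z2 => [x1 y1] [x2 y2] [-> im0] [-> im1]; split=> //=.
  by apply/eqP; rewrite -addr_eq0; apply/eqP; lra.
move=> y1_neq0; apply: (mulfI y1_neq0).
have -> : y1 * x2 = - (x1 * y2) by apply/eqP; rewrite -addr_eq0 addrC -im0.
have -> : y2 = - y1 by apply/eqP; rewrite -addr_eq0; apply/eqP; lra.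
ring.
Qed.

End polynomials.

Theorem corollary3p4 (R : realType) (P Q : {poly R})
  (P_monic : P \is monic) (P_deg : size P = 4%N)
  (Q_monic : Q \is monic) (Q_deg : size Q = 3%N)
  (P_causal : no_zero_Cplus P) (Q_invertible : no_zero_Cplus Q)
  (d : measure_display) (Omega : measurableType d) (Pr : probability Omega R)
  (L1 L2 : R -> Omega -> R)
  (L1_sub : subordinator Pr L1) (L2_sub : subordinator Pr L2)
  (L12_indep : independent_processes Pr L1 L2) (L12_law : same_law Pr L1 L2)
  (L : R -> Omega -> R) (L_def : L = two_sided L1 L2)
  (nu : {measure set R -> \bar R})
  (nu_levy : levy_measure Pr L nu) (nu_neq0 : nu setT <> 0%E)
  (L_mean : ('E_Pr[L 1%R] < +oo)%E)
  (Y : R -> Omega -> R) (Y_def : Y = carma P Q L)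
  (beta1 beta2 : R[i])
  (beta_zeroes : Cpoly Q = ('X - beta1%:P) * ('X - beta2%:P))
  (beta_order : complex.Re beta2 <= complex.Re beta1)
  (lambda : R) (S : {poly R}) (S_def : S = ('X + lambda%:P) * Q - P)
  (S_deg : (size S <= 2)%N)
  (S_nondegenerate : complex.Im beta1 <> 0 -> S <> 0) :
  let b1 := complex.Re beta1 in
  let b2 := complex.Re beta2 in
  let real_zeroes := complex.Im beta1 = 0 /\ complex.Im beta2 = 0 in
  let cond_i := b2 < b1 /\ P.[b1] <= Num.min P.[b2] 0 in
  let cond_ii := b1 = b2 /\ Num.max P.[b1] P^`().[b1] <= 0 in
  (forall f : R -> R,
     continuous_with_fourier f
       (fun y => (Cpoly S).[0 +i* y] / (Cpoly Q).[0 +i* y]) ->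
     (forall t, 0 <= t -> 0 <= f t) <->
     (real_zeroes /\ (cond_i \/ cond_ii))) /\
  (real_zeroes /\ (cond_i \/ cond_ii) ->
   forall t, {ae Pr, forall omega, 0 <= Y t omega}).
Proof.
move=> b1 b2 real_zeroes cond_i cond_ii.
have Qi y : (Cpoly Q).[0 +i* y] = (Q`_0 - y ^+ 2) +i* (Q`_1 * y).
  rewrite horner_Cpoly_imaginary ?Q_deg//.
  have -> : Q`_2 = 1 by move/monicP: Q_monic; rewrite /lead_coef Q_deg.
  by rewrite mul1r.
have Qi0 y : (Q`_0 - y ^+ 2) +i* (Q`_1 * y) != 0.
  by rewrite -Qi; exact: Q_invertible.
have Si y : (Cpoly S).[0 +i* y] = S`_0 +i* (S`_1 * y).
  rewrite horner_Cpoly_imaginary ?(leq_trans S_deg)//.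
  by rewrite [S`_2]nth_default// mul0r subr0.
have F_E : (fun y => (Cpoly S).[0 +i* y] / (Cpoly Q).[0 +i* y]) =
    (fun y => (S`_0 +i* (S`_1 * y)) / ((Q`_0 - y ^+ 2) +i* (Q`_1 * y))).
  by apply/funext => y; rewrite Qi Si.
rewrite F_E {F_E}.
have b1_lt0 : b1 < 0.
  rewrite ltNge; apply/negP => /Q_invertible/negP; apply.
  by rewrite beta_zeroes rootM root_XsubC eqxx.
have Cq0 : (Q`_0)%:C = beta1 * beta2.
  rewrite -[LHS](coef_map (real_complex R)) -/(Cpoly Q) beta_zeroes.
  by case: (monic_quadratic_coef beta1 beta2).
have Cq1 : (Q`_1)%:C = - (beta1 + beta2).
  rewrite -[LHS](coef_map (real_complex R)) -/(Cpoly Q) beta_zeroes.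
  by case: (monic_quadratic_coef beta1 beta2).
have [q0E q1E y2E x2E] := real_quadratic_roots Cq0 Cq1.
have real_case : complex.Im beta1 = 0 -> complex.Im beta2 = 0 ->
    Q = ('X - b1%:P) * ('X - b2%:P).
  move=> y10 y20; apply: (map_inj_poly (@complexI R) (erefl _)).
  rewrite rmorphM !rmorphB/= !map_polyX !map_polyC/=.
  rewrite -[map_poly _ Q]/(Cpoly Q) beta_zeroes.
  have -> : beta1 = b1%:C by apply/eqP; rewrite eq_complex/= y10 !eqxx.
  by have -> : beta2 = b2%:C by apply/eqP; rewrite eq_complex/= y20 !eqxx.
have condP : real_zeroes -> cond_i \/ cond_ii <-> 0 <= S.[b1] /\ 0 <= S`_1.
  by move=> [y10 y20]; exact: (carma_conditionsP (real_case y10 y20) S_def S_deg).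
split; last first.
  move=> [rz /(condP rz)[Sb1 S1]] t; apply/aeW => omega; rewrite Y_def.
  apply: carma_ge0 => s s0; case: rz => y10 y20.
  exact: (carma_kernel_ge0 P_deg P_monic (real_case y10 y20) S_def S_deg).
move=> f.
have [y10|y10] := eqVneq (complex.Im beta1) 0.
  have y20 : complex.Im beta2 = 0 by rewrite y2E y10 oppr0.
  have {}q0E : Q`_0 = b1 * b2 by rewrite q0E y10 mul0r subr0.
  move=> Ff.
  have rz : real_zeroes by [].
  have key : (forall t, 0 <= t -> 0 <= f t) <-> 0 <= S.[b1] /\ 0 <= S`_1.
    rewrite horner_size2//.
    apply: (fourier_real_ge0 beta_order b1_lt0) => [y|]; rewrite -q0E -q1E//.
  split=> [/key/(condP rz)//|[_ /(condP rz)/key]//].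
move=> Ff; split=> [f0|[[y10']]]; last by move: y10; rewrite y10' eqxx.
exfalso; move: f0.
have q0E' : Q`_0 = b1 ^+ 2 + `|complex.Im beta1| ^+ 2.
  by rewrite q0E y2E x2E// mulrN opprK real_normK ?num_real// !expr2.
have q1E' : Q`_1 = - (2 * b1) by rewrite q1E x2E// mulr_natl mulr2n.
apply: (@fourier_complex_not_ge0 _ b1 `|complex.Im beta1| S`_0 S`_1) => //.
- by rewrite normr_gt0.
- rewrite -negb_and; apply/negP => /andP[/eqP s0 /eqP s1].
  apply: (S_nondegenerate (elimN eqP y10)); apply/polyP => -[|[|i]].
  + by rewrite s0 coef0.
  + by rewrite s1 coef0.
  + by rewrite coef0 nth_default// (leq_trans S_deg).
- by move=> y; rewrite -q0E' -q1E'.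
- by under eq_fun do rewrite -q0E' -q1E'.
Qed.
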